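(* Let $G$ be a finite abelian group and $p$ an odd prime. Assume there exists an automorphism $\alpha$ of $G$ of order $p$ whose only fixed point is the zero element of $G$. Then $\mathbb{Z}_p\times G$ is not a CI-group with respect to color ternary relational structures. Moreover, if there exists a ternary relational structure with vertex set $G$ whose automorphism group is $\langle G_L,\alpha\rangle$ (with $G_L$ acting by translation and $\alpha$ acting as an automorphism), then $\mathbb{Z}_p\times G$ is not a CI-group with respect to ternary relational structures.
   Context: A (color) ternary relational structure is a pair $X=(V,E)$ with $E\subseteq V^3$ (resp. $X=(V,(E_1,\ldots,E_c))$ with pairwise disjoint $E_i\subseteq V^3$); automorphisms are permutations of $V$ preserving $E$ (resp. each $E_i$). For a group $H$, $H_L=\{h\mapsto gh: g\in H\}$. $X$ is a Cayley object of $H$ if $V=H$ and $H_L\le\mathrm{Aut}(X)$. $H$ is a CI-group with respect to a class $\mathcal{C}$ of Cayley objects of $H$ if any two $X,Y\in\mathcal{C}$ are isomorphic if and only if they are isomorphic via a group automorphism of $H$. *)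

(* Defs.v *)
From HB Require Import structures.
From mathcomp Require Import all_boot all_order all_algebra all_fingroup.

Set Implicit Arguments.
Unset Strict Implicit.
Unset Printing Implicit Defensive.

Local Open Scope group_scope.

Definition triple_map (V : finType) (s : {perm V}) (t : V * V * V) : V * V * V :=
  (s t.1.1, s t.1.2, s t.2).

Definition ternary (V : finType) := {set V * V * V}.

Definition ternary_iso (V : finType) (s : {perm V}) (X Y : ternary V) : bool :=
  triple_map s @: X == Y.

(* The i-th item of the sequence is E_i; some of the E_i may be empty. *)
Record color_ternary (V : finType) := ColorTernary {
  colors :> seq (ternary V);
  _ : pairwise (fun E F : ternary V => [disjoint E & F]) colors
}.

(* Equality of sequences: isomorphic structures have the same number c of
   relations, and E_i is mapped onto F_i for each i (colors are not permuted). *)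
Definition color_ternary_iso (V : finType) (s : {perm V})
    (X Y : color_ternary V) : bool :=
  [seq triple_map s @: E | E : ternary V <- X] == Y.

(* A kind of relational structures on V is given by a type S of structures and
   a predicate iso, where iso s X Y means that s is an isomorphism X -> Y. *)
Definition automorphisms (V : finType) (S : Type)
    (iso : {perm V} -> S -> S -> bool) (X : S) : {set {perm V}} :=
  [set s | iso s X X].

Definition left_translation (gT : finGroupType) (g : gT) : {perm gT} :=
  perm (@mulgI gT g).

Definition left_translations (gT : finGroupType) : {set {perm gT}} :=
  [set left_translation g | g : gT].

Definition Cayley_object (gT : finGroupType) (S : Type)
    (iso : {perm gT} -> S -> S -> bool) (X : S) : Prop :=
  left_translations gT \subset automorphisms iso X.

(* The class considered is that of all Cayley objects of gT of the given kind. *)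
Definition CI_group (gT : finGroupType) (S : Type)
    (iso : {perm gT} -> S -> S -> bool) : Prop :=
  forall X Y : S, Cayley_object iso X -> Cayley_object iso Y ->
    (exists s : {perm gT}, iso s X Y) <->
    (exists2 s : {perm gT}, s \in Aut [set: gT] & iso s X Y).

Definition CI_group_ternary (gT : finGroupType) : Prop :=
  CI_group (@ternary_iso gT).

Definition CI_group_color_ternary (gT : finGroupType) : Prop :=
  CI_group (@color_ternary_iso gT).

(* Main.v *)
(** Write [a] for the automorphism [alpha].  Consider two ternary structures on
[Z_p * G]: both contain the triples [(i, x), (i, y), (i, z)] with
[a x * z = x * a y]; the first one also contains the triples
[(i, x), (i + 1, y), (i + 2, z)] with [a x * z = y * a y], the second one those
with [x * a z = y * a y].  The permutation [(i, x) |-> (i, a^i x)] maps the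
second structure onto the first.  Since [a] has only one fixed point, [p] does
not divide the order of [G], so an automorphism of [Z_p * G] respects the
factors; if it maps the second structure onto the first, the triples with
constant [i] show that its restriction to [G] commutes with [a], and then the
other triples show that [a^2] has a nontrivial fixed point, which is impossible
for odd [p].  A structure with a single color gives the colored case. *)

Require Import Defs.
From HB Require Import structures.
From mathcomp Require Import all_boot all_order all_algebra all_fingroup.
From mathcomp Require Import cyclic pgroup sylow.

Set Implicit Arguments.
Unset Strict Implicit.
Unset Printing Implicit Defensive.

Local Open Scope group_scope.

Lemma triple_map_inj (V : finType) (s : {perm V}) : injective (triple_map s).
Proof.
by move=> [[x y] z] [[x' y'] z'] [/perm_inj-> /perm_inj-> /perm_inj->].
Qed.

Lemma ternary_isoP (V : finType) (s : {perm V}) (X Y : ternary V) :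
  reflect (forall x y z, ((s x, s y, s z) \in Y) = ((x, y, z) \in X))
          (ternary_iso s X Y).
Proof.
apply: (iffP eqP) => [<- x y z | XY].
  exact: (mem_imset X (x, y, z) (@triple_map_inj _ s)).
apply/setP=> -[[x y] z].
rewrite -(permKV s x) -(permKV s y) -(permKV s z) XY.
exact: (mem_imset X (_, _, _) (@triple_map_inj _ s)).
Qed.

Lemma Cayley_object_ternaryP (gT : finGroupType) (X : ternary gT) :
  (forall g x y z, ((g * x, g * y, g * z) \in X) = ((x, y, z) \in X)) ->
  Cayley_object (@ternary_iso gT) X.
Proof.
move=> Xg; apply/subsetP=> _ /imsetP[g _ ->]; rewrite inE.
by apply/ternary_isoP=> x y z; rewrite !permE Xg.
Qed.

Lemma pairwise_disjoint1 (V : finType) (X : ternary V) :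
  pairwise (fun E F : ternary V => [disjoint E & F]) [:: X].
Proof. by []. Qed.

Lemma CI_group_color_ternary_ternary (gT : finGroupType) :
  CI_group_color_ternary gT -> CI_group_ternary gT.
Proof.
move=> CI X Y; pose mono (Z : ternary gT) := ColorTernary (pairwise_disjoint1 Z).
have isoE s A B : color_ternary_iso s (mono A) (mono B) = ternary_iso s A B.
  by rewrite /color_ternary_iso /= eqseq_cons andbT.
have CayleyE A : Cayley_object (@ternary_iso gT) A ->
    Cayley_object (@color_ternary_iso gT) (mono A).
  by move=> /subsetP cA; apply/subsetP=> s /cA; rewrite !inE isoE.
move=> /CayleyE cX /CayleyE cY; have [XY YX] := CI _ _ cX cY.
split=> [[s s_iso] | [s _ s_iso]]; last by exists s.
by have [|t At] := XY; [exists s; rewrite isoE | rewrite isoE; exists t].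
Qed.

Lemma autM (gT : finGroupType) (s : {perm gT}) :
  s \in Aut [set: gT] -> {morph s : x y / x * y}.
Proof. by rewrite inE => /andP[_ /morphicP sM] x y; apply: sM; rewrite inE. Qed.

Lemma aut1 (gT : finGroupType) (s : {perm gT}) : s \in Aut [set: gT] -> s 1 = 1.
Proof. by move=> /autM sM; apply: (mulgI (s 1)); rewrite -sM !mulg1. Qed.

Lemma autX (gT : finGroupType) (s : {perm gT}) n :
  s \in Aut [set: gT] -> {morph s : x / x ^+ n}.
Proof.
move=> As x; elim: n => [|n IHn]; first exact: aut1.
by rewrite !expgS autM // IHn.
Qed.

(** The [p]-group [<[a]>] acts on [gT] with [1] as its only fixed point, so [#|gT|] is congruent to
    1 modulo [p]. *)
Lemma card_coprime_fixed_point_free (gT : finGroupType) (a : {perm gT}) p :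
  prime p -> #[a] = p -> (forall x, a x = x <-> x = 1) -> coprime #|gT| p.
Proof.
move=> p_pr oa fix_a.
have pa : p.-group <[a]> by rewrite /pgroup -orderE oa pnat_id.
have aT : [acts <[a]>, on [set: gT] | 'P].
  by apply/subsetP=> x _; rewrite !inE; apply/subsetP=> y; rewrite !inE.
have := pgroup_fix_mod pa aT; rewrite setTI afix_cycle.
have -> : 'Fix_'P[a] = [set 1 : gT].
  by apply/setP=> x; rewrite in_set1; apply/afix1P/eqP=> [/fix_a | /fix_a].
rewrite cardsT cards1 => modp.
by rewrite /coprime -gcdn_modl modp gcdn_modl gcd1n.
Qed.

Section BlockStructure.

Variables (gT : finGroupType) (p : nat) (a : {perm gT}).
Hypothesis (mulC : forall x y : gT, x * y = y * x) (Aa : a \in Aut [set: gT]).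

(** Taking [a, id] for [f, g] gives the first structure described above, and [id, a] the second. *)
Definition block_structure (f g : gT -> gT) : ternary ('Z_p * gT)%type :=
  [set t : ('Z_p * gT) * ('Z_p * gT) * ('Z_p * gT) |
    let: (P, Q, R) := t in
    [&& Q.1 == (P.1 + 1)%R, R.1 == (Q.1 + 1)%R & f P.2 * g R.2 == Q.2 * a Q.2]
    || [&& Q.1 == P.1, R.1 == P.1 & a P.2 * R.2 == P.2 * a Q.2]].

(** Translation by [(k, c)] shifts the indices by [k] and multiplies both sides of either equation
    by [c * a c]; for [f] and [g] this is the last hypothesis. *)
Lemma Cayley_block_structure (f g : gT -> gT) :
  {morph f : x y / x * y} -> {morph g : x y / x * y} ->
  (forall x, f x * g x = x * a x) ->
  Cayley_object (@ternary_iso ('Z_p * gT)%type) (block_structure f g).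
Proof.
move=> fM gM fg; apply: Cayley_object_ternaryP.
have ACA x y z t : (x * y) * (z * t) = (x * z) * (y * t) :> gT.
  by rewrite -!mulgA (mulgA y) (mulC y z) !mulgA.
move=> [k c] [i x] [j y] [l z]; rewrite !inE /= fM gM !(autM Aa).
rewrite (ACA (f c)) (ACA c y) (ACA (a c)) (ACA c x) fg (mulC (a c)).
rewrite !(inj_eq (mulgI _)).
(* The group law of ['Z_p] is addition: the group identity [1] is the ring zero, and [1%R] is a
   generator. *)
have shift u v : ((k * u)%g == (k * v)%g + 1)%R = (u == v + 1)%R.
  rewrite -[((k * v)%g + 1)%R]/(k * v * (1%R : 'Z_p)) -mulgA.
  exact: (inj_eq (mulgI k)).
by rewrite !shift.
Qed.

Definition shear_fun (P : 'Z_p * gT) : 'Z_p * gT := (P.1, (a ^+ P.1) P.2).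

Lemma shear_fun_inj : injective shear_fun.
Proof. by move=> [i x] [j y] [/= -> /perm_inj->]. Qed.

Definition shear : {perm 'Z_p * gT} := perm shear_fun_inj.

(** The equation for the image triple is the original one with [a ^+ (i + 1)] applied to both sides,
    or [a ^+ i] when the index is constant. *)
Lemma shear_block_structure : 1 < p -> #[a] = p ->
  ternary_iso shear (block_structure id a) (block_structure a id).
Proof.
move=> p_gt1 oa.
(* When [i + 1] wraps around to 0, the power is unchanged because [a] has order [p]. *)
have aS (i : 'Z_p) x : (a ^+ (i + 1)%R) x = (a ^+ i) (a x).
  have -> : a ^+ (i + 1)%R = a ^+ i.+1.
    rewrite -[RHS]expg_mod_order oa -[X in _ = a ^+ (_ %% X)](Zp_cast p_gt1).
    by rewrite -(addn1 i) -(modnDmr i 1).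
  by rewrite expgS permM.
have aC n x : a ((a ^+ n) x) = (a ^+ n) (a x).
  by rewrite -!permM -expgS -expgSr.
have aXM n : {morph a ^+ n : x y / x * y} by apply/autM/groupX.
apply/ternary_isoP=> -[i x] [j y] [k z]; rewrite !inE /= !permE /shear_fun /=.
congr (_ || _).
  case: eqP => //= ->; case: eqP => //= ->.
  by rewrite !aS !aC -!aXM !(inj_eq perm_inj) -!(autM Aa) (inj_eq perm_inj).
case: eqP => //= ->; case: eqP => //= ->.
by rewrite !aC -!aXM (inj_eq perm_inj).
Qed.

Lemma no_aut_block_structure (s : {perm 'Z_p * gT}) :
  odd p -> 1 < p -> #[a] = p -> coprime #|gT| p ->
  (forall x, a x = x <-> x = 1) ->
  s \in Aut [set: 'Z_p * gT] ->
  ~~ ternary_iso s (block_structure id a) (block_structure a id).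
Proof.
move=> p_odd p_gt1 oa co_p fix_a As; apply/negP=> /ternary_isoP s_iso.
have eq1 (hT : finGroupType) (x : hT) m n :
    coprime m n -> x ^+ m = 1 -> x ^+ n = 1 -> x = 1.
  move=> /eqP co_mn xm xn; apply/eqP; rewrite -order_eq1 -dvdn1 -co_mn.
  by rewrite dvdn_gcd !order_dvdn xm xn eqxx.
have fstX n (P : 'Z_p * gT) : (P ^+ n).1 = P.1 ^+ n.
  by elim: n => // n IHn; rewrite !expgS -IHn.
have sndX n (P : 'Z_p * gT) : (P ^+ n).2 = P.2 ^+ n.
  by elim: n => // n IHn; rewrite !expgS -IHn.
have Zp1 (i : 'Z_p) : i ^+ p = 1.
  by have := expg_cardG (in_setT i); rewrite cardsT card_ord Zp_cast.
have gT1 (x : gT) : x ^+ #|gT| = 1.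
  by have := expg_cardG (in_setT x); rewrite cardsT.
(* The first coordinate of [s P] is killed by both [#|gT|] and [p], which are coprime. *)
have s_fst P : P.1 = 1 -> (s P).1 = 1.
  move=> P1; apply: (eq1 _ _ _ _ co_p); last exact: Zp1.
  rewrite -fstX -autX //; have -> : P ^+ #|gT| = 1; last by rewrite aut1.
  by rewrite [LHS]surjective_pairing fstX sndX P1 expg1n gT1.
have s_snd P : P.2 = 1 -> (s P).2 = 1.
  move=> P2; apply: (eq1 _ _ _ _ co_p); first exact: gT1.
  rewrite -sndX -autX //; have -> : P ^+ p = 1; last by rewrite aut1.
  by rewrite [LHS]surjective_pairing fstX sndX P2 expg1n Zp1.
pose c i := (s (i, 1)).1; pose b x := (s (1, x)).2.
have sE i x : s (i, x) = (c i, b x).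
  have -> : (i, x) = (i, 1) * (1, x).
    by rewrite [RHS]surjective_pairing /= mulg1 mul1g.
  rewrite autM // [LHS]surjective_pairing /= (s_fst (1, x)) //.
  by rewrite (s_snd (i, 1)) // mulg1 mul1g.
have c1 : c 1 = 1 by apply: s_fst.
have b1 : b 1 = 1 by apply: s_snd.
have bM x y : b (x * y) = b x * b y.
  rewrite /b; have -> : (1, x * y) = (1, x) * (1, y) :> 'Z_p * gT.
    by rewrite [RHS]surjective_pairing /= mul1g.
  by rewrite autM.
have neq01 : ((1 : 'Z_p) == ((1%g : 'Z_p) + 1)%R) = false by [].
have b_eq1 y : b y = 1 -> y = 1.
  move=> by1; suff /perm_inj[] : s (1, y) = s (1, 1) by [].
  by rewrite !sE by1 b1.
(* The test triple has constant index; [neq01] excludes the other kind for its image. *)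
have b_a y : b (a y) = a (b y).
  have := s_iso (1, 1) (1, y) (1, a y).
  rewrite !sE !inE /= c1 b1 (aut1 Aa) !mul1g neq01 !eqxx /=.
  by move/eqP.
(* With third entry trivial, the equation forces [y * a y] as first entry. The image cannot have
   constant index, since [c] is injective. *)
have a2 y : a (a (b y)) = b y.
  have := s_iso (1, y * a y) (1%R, y) ((1 + 1)%R, 1).
  rewrite !sE !inE /= c1 b1 (aut1 Aa) !mulg1 !eqxx /=.
  case/orP=> [/and3P[_ _ /eqP] | /and3P[/eqP c_eq1 _ _]].
    by rewrite bM b_a (autM Aa) (mulC (b y)) => /mulgI.
  have /perm_inj[] : s (1%R, 1) = s (1, 1) by rewrite !sE c1 c_eq1.
  by [].
(* As [p] is odd, [a ^+ p = 1] is [a] times a power of [a ^+ 2], and the latter fixes [b y]. *)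
have a_b y : a (b y) = b y.
  have a2n n : (a ^+ n.*2) (b y) = b y.
    by elim: n => [|n IHn]; rewrite ?perm1 // doubleS !expgSr !permM IHn a2.
  have := expg_order a; rewrite oa -(odd_double_half p) p_odd expgSr.
  by move/permP/(_ (b y)); rewrite permM a2n perm1.
(* Every [b y] is now fixed by [a], so [gT] is trivial, against [#[a] > 1]. *)
suff a1 : a = 1 by move: p_gt1; rewrite -oa a1 order1.
apply/permP=> y; rewrite perm1.
by apply/fix_a/b_eq1/fix_a.
Qed.

End BlockStructure.

Lemma not_CI_group_ternary_Zp_prod (gT : finGroupType) (p : nat)
    (a : {perm gT}) :
  abelian [set: gT] -> prime p -> odd p -> a \in Aut [set: gT] -> #[a] = p ->
  (forall x, a x = x <-> x = 1) -> ~ CI_group_ternary ('Z_p * gT)%type.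
Proof.
move=> /centsP cGG p_pr p_odd Aa oa fix_a CI.
have mulC (x y : gT) : x * y = y * x by apply: cGG; rewrite inE.
have p_gt1 := prime_gt1 p_pr.
have aM := autM Aa.
have cX := Cayley_block_structure p mulC Aa aM (fun _ _ => erefl)
  (fun x => mulC _ _).
have cY := Cayley_block_structure p mulC Aa (fun _ _ => erefl) aM
  (fun x => erefl).
have [iso_aut _] := CI _ _ cY cX.
have [|s As sYX] := iso_aut.
  by exists (shear p a); apply: shear_block_structure.
have := no_aut_block_structure mulC Aa p_odd p_gt1 oa
  (card_coprime_fixed_point_free p_pr oa fix_a) fix_a As.
by rewrite sYX.
Qed.

Theorem theorem2p1 (gT : finGroupType) (p : nat) (alpha : {perm gT})
    (gT_abelian : abelian [set: gT])
    (p_prime : prime p) (p_odd : odd p)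
    (alpha_aut : alpha \in Aut [set: gT])
    (alpha_order : #[alpha] = p)
    (alpha_fix : forall x : gT, alpha x = x <-> x = 1) :
  ~ CI_group_color_ternary ('Z_p * gT)%type
  /\ ((exists X : ternary gT,
         automorphisms (@ternary_iso gT) X
         = <<left_translations gT :|: [set alpha]>>) ->
      ~ CI_group_ternary ('Z_p * gT)%type).
Proof.
have notCI := not_CI_group_ternary_Zp_prod gT_abelian p_prime p_odd alpha_aut
  alpha_order alpha_fix.
by split=> [/CI_group_color_ternary_ternary | _].
Qed.
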